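(* Let $\lambda$ be a nonzero real number, $r\geq 0$ an integer, $z\in\mathbb{C}$, and let $f(t)=\langle z|e_\lambda^{r+\hat n}(t)|z\rangle$. Then $$\frac{f'(t)}{f(t)}=|z|^2e_\lambda^{1-\lambda}(t)+re_\lambda^{-\lambda}(t).$$
   Context: Number states $|m\rangle$, $m\ge0$, form an orthonormal basis; $a|m\rangle=\sqrt{m}\,|m-1\rangle$ ($a|0\rangle=0$), $a^\dagger|m\rangle=\sqrt{m+1}\,|m+1\rangle$, $\hat n=a^\dagger a$. The coherent state is $|z\rangle=e^{-|z|^2/2}\sum_{m\ge0}\frac{z^m}{\sqrt{m!}}|m\rangle$, and $\langle z|A|z\rangle$ is the inner product of $|z\rangle$ with $A|z\rangle$. Degenerate falling factorials: $(x)_{0,\lambda}=1$, $(x)_{k,\lambda}=x(x-\lambda)\cdots(x-(k-1)\lambda)$, and similarly for operators. The degenerate exponential is $e_\lambda^x(t)=(1+\lambda t)^{x/\lambda}=\sum_{k\ge0}(x)_{k,\lambda}\frac{t^k}{k!}$; for the operator, $e_\lambda^{r+\hat n}(t)=\sum_{k\ge0}(\hat n+r)_{k,\lambda}\frac{t^k}{k!}$, so $f(t)=\sum_{k\ge0}\langle z|(\hat n+r)_{k,\lambda}|z\rangle\frac{t^k}{k!}$ (a power series in $t$ with $f(0)=1$), and $f'$ denotes its derivative in $t$. *)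

(* Defs.v *)
From Stdlib Require Import Reals Factorial.
From Coquelicot Require Import Coquelicot.
Open Scope R_scope.

(* A state [psi] is given by its coordinates in the number basis: [psi m] is
   the coefficient of |m>.  Operators are defined on all coordinate sequences;
   [in_l2] singles out the vectors of the Hilbert space. *)
Definition state := nat -> C.
Definition operator := state -> state.

Definition in_l2 (psi : state) : Prop := ex_series (fun m => Cmod (psi m) ^ 2).

(* A convergent complex series has this sum; the value carries no information
   when the series diverges. *)
Definition CSeries (u : nat -> C) : C :=
  (Series (fun m => Re (u m)), Series (fun m => Im (u m))).

(* Antilinear in the first argument. *)
Definition inner (phi psi : state) : C :=
  CSeries (fun m => (Cconj (phi m) * psi m)%C).

Definition ket (m : nat) : state := fun j => if Nat.eqb j m then RtoC 1 else RtoC 0.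

(* Coordinate form of a|m> = sqrt m |m-1>, a|0> = 0; see [annihilation_ket_0]
   and [annihilation_ket_S]. *)
Definition annihilation : operator :=
  fun psi m => (RtoC (sqrt (INR (S m))) * psi (S m))%C.

(* Coordinate form of a^dagger |m> = sqrt (m+1) |m+1>; see [creation_ket]. *)
Definition creation : operator :=
  fun psi m =>
    match m with
    | O => RtoC 0
    | S j => (RtoC (sqrt (INR (S j))) * psi j)%C
    end.

Definition number_op : operator := fun psi => creation (annihilation psi).

Definition op_shift (A : operator) (c : R) : operator :=
  fun psi m => (A psi m + RtoC c * psi m)%C.

(* (A)_{k,lam} = A (A - lam) ... (A - (k-1) lam). *)
Fixpoint op_falling (lam : R) (k : nat) (A : operator) : operator :=
  match k with
  | O => fun psi => psi
  | S j => fun psi => op_falling lam j A (op_shift A (- (INR j * lam)) psi)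
  end.

Definition coherent (z : C) : state :=
  fun m => (RtoC (exp (- (Cmod z ^ 2) / 2)) * (z ^ m / RtoC (sqrt (INR (fact m)))))%C.

Definition expectation (z : C) (A : operator) : C :=
  inner (coherent z) (A (coherent z)).

(* k-th term of the expansion of <z| e_lam^{r + n}(t) |z> in powers of t. *)
Definition deg_exp_term (lam : R) (r : nat) (z : C) (t : R) (k : nat) : C :=
  (expectation z (op_falling lam k (op_shift number_op (INR r)))
     * RtoC (t ^ k / INR (fact k)))%C.

Definition deg_exp_expectation (lam : R) (r : nat) (z : C) (t : R) : C :=
  CSeries (deg_exp_term lam r z t).

(* e_lam^x(t) = (1 + lam t)^(x / lam), meaningful for 0 < 1 + lam t. *)
Definition deg_exp (lam x t : R) : R := Rpower (1 + lam * t) (x / lam).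

Lemma annihilation_ket_0 (j : nat) : annihilation (ket 0) j = RtoC 0.
Proof. unfold annihilation, ket; simpl. ring. Qed.

Lemma annihilation_ket_S (m j : nat) :
  annihilation (ket (S m)) j = (RtoC (sqrt (INR (S m))) * ket m j)%C.
Proof.
unfold annihilation, ket; cbn [Nat.eqb].
destruct (Nat.eqb_spec j m) as [-> | _]; ring.
Qed.

Lemma creation_ket (m j : nat) :
  creation (ket m) j = (RtoC (sqrt (INR (S m))) * ket (S m) j)%C.
Proof.
unfold creation, ket; destruct j as [| j]; cbn [Nat.eqb].
- ring.
- destruct (Nat.eqb_spec j m) as [-> | _]; ring.
Qed.

(* Main.v *)
(* The number operator is diagonal, so [<z|(n + r)_{k,lam}|z>] is the Poisson average
   of [(m + r)_{k,lam}] with parameter [x = |z|^2].  For [|lam t| < 1] the double series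
   over [k] and [m] converges absolutely, its absolute version being dominated by the
   binomial series with [- |lam|] and [|t|].  Summing over [k] first, by the binomial
   series, and then over [m] gives
   [f(t) = exp (x (e_lam(t) - 1)) e_lam^r(t)], whose logarithmic derivative is read off
   from [(e_lam^y)' = y e_lam^(y - lam)]. *)
Require Import Defs.
From Stdlib Require Import Reals Factorial Lra Lia.
From Coquelicot Require Import Coquelicot.
Open Scope R_scope.

(** * Dominated convergence for series and interchange of double sums *)

Lemma Series_le_sum_n_tail (a b : nat -> R) (M : nat) :
  (forall m, 0 <= a m <= b m) -> ex_series b ->
  Series a <= sum_n a M + (Series b - sum_n b M).
Proof.
  intros Hab Hb.
  assert (Ha : ex_series a).
  { apply (ex_series_le a b); [|exact Hb].
    intro m. change (Rabs (a m) <= b m).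
    rewrite Rabs_pos_eq; apply Hab. }
  (* [sum_n] includes the index [M], so the tails start at [S M]. *)
  rewrite (Series_incr_n a (S M)) by (trivial; lia).
  rewrite (Series_incr_n b (S M)) by (trivial; lia).
  simpl pred. rewrite !sum_n_Reals.
  assert (Series (fun k => a (S M + k)%nat) <= Series (fun k => b (S M + k)%nat)).
  { apply Series_le; [intro; apply Hab|].
    now apply (ex_series_incr_n b (S M)). }
  lra.
Qed.

Lemma is_lim_seq_sum_n (u : nat -> nat -> R) (l : nat -> R) (M : nat) :
  (forall m, is_lim_seq (fun n => u n m) (l m)) ->
  is_lim_seq (fun n => sum_n (u n) M) (sum_n l M).
Proof.
  intros Hu. induction M as [|M IH].
  - rewrite sum_O. apply (is_lim_seq_ext (fun n => u n O)); [|apply Hu].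
    intro n; now rewrite sum_O.
  - rewrite sum_Sn. apply (is_lim_seq_ext (fun n => sum_n (u n) M + u n (S M))).
    + intro n; now rewrite sum_Sn.
    + apply (is_lim_seq_plus' _ _ _ _ IH (Hu _)).
Qed.

(** Tannery's theorem. The differences [d n m] are bounded by [2 * b m], so their tails are small
    uniformly in [n], while a finite head tends to 0 by termwise convergence. *)
Lemma is_lim_seq_Series_dominated (u : nat -> nat -> R) (b l : nat -> R) :
  (forall n m, Rabs (u n m) <= b m) -> ex_series b ->
  (forall m, is_lim_seq (fun n => u n m) (l m)) ->
  is_lim_seq (fun n => Series (u n)) (Series l).
Proof.
  intros Hub Hb Hul.
  assert (Hlb : forall m, Rabs (l m) <= b m).
  { intro m. apply (is_lim_seq_le (fun n => Rabs (u n m)) (fun _ => b m)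
                      (Rabs (l m)) (b m)).
    - intro n; apply Hub.
    - apply (is_lim_seq_abs _ (l m)), Hul.
    - apply is_lim_seq_const. }
  assert (Hu : forall n, ex_series (u n)) by (intro n; now apply (ex_series_le (u n) b)).
  assert (Hl : ex_series l) by now apply (ex_series_le l b).
  set (d := fun n m => Rabs (u n m - l m)).
  assert (Hd : forall n m, 0 <= d n m <= 2 * b m).
  { intros n m; unfold d; split; [apply Rabs_pos|].
    apply (Rle_trans _ _ _ (Rabs_triang _ _)). rewrite Rabs_Ropp.
    specialize (Hub n m); specialize (Hlb m); lra. }
  assert (H2b : ex_series (fun m => 2 * b m)) by now apply (ex_series_scal_l 2 b).
  assert (Hdu : forall n, Rabs (Series (u n) - Series l) <= Series (d n)).
  { intro n. rewrite <- Series_minus by trivial.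
    apply Series_Rabs. apply (ex_series_le (d n) (fun m => 2 * b m)); trivial.
    intro m. change (Rabs (d n m) <= 2 * b m). rewrite Rabs_pos_eq; apply Hd. }
  apply is_lim_seq_spec. intros eps.
  assert (Hcv : is_lim_seq (sum_n (fun m => 2 * b m)) (Series (fun m => 2 * b m)))
    by now apply Series_correct.
  apply is_lim_seq_spec in Hcv.
  (* [M] is chosen first, from the majorant alone, to make the tail less than [eps / 2]; [N] then
     depends on [M] and handles the head. *)
  destruct (Hcv (pos_div_2 eps)) as [M HM].
  specialize (HM M (Nat.le_refl M)). simpl in HM.
  assert (Hs : is_lim_seq (fun n => sum_n (d n) M) (sum_n (fun _ => 0) M)).
  { apply is_lim_seq_sum_n. intro m. unfold d.
    replace 0 with (Rabs (l m - l m)) by (rewrite Rminus_diag; apply Rabs_R0).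
    apply (is_lim_seq_abs _ (l m - l m)).
    apply is_lim_seq_minus'; [apply Hul | apply is_lim_seq_const]. }
  apply is_lim_seq_spec in Hs.
  destruct (Hs (pos_div_2 eps)) as [N HN]. exists N. intros n Hn.
  specialize (HN n Hn). simpl in HN.
  rewrite sum_n_const, Rmult_0_r, Rminus_0_r in HN.
  pose proof (Series_le_sum_n_tail (d n) (fun m => 2 * b m) M (Hd n) H2b).
  specialize (Hdu n).
  apply Rabs_def2 in HM. apply Rabs_def2 in HN. lra.
Qed.

Lemma sum_n_Series (u : nat -> nat -> R) (K : nat) :
  (forall k, ex_series (u k)) ->
  ex_series (fun m => sum_n (fun k => u k m) K) /\
  sum_n (fun k => Series (u k)) K = Series (fun m => sum_n (fun k => u k m) K).
Proof.
  intros Hu. induction K as [|K [IHe IH]].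
  - split.
    + apply (ex_series_ext (u O)); [|apply Hu]. intro m; now rewrite sum_O.
    + rewrite sum_O. apply Series_ext. intro m; now rewrite sum_O.
  - assert (He : forall m, sum_n (fun k => u k m) K + u (S K) m
                           = sum_n (fun k => u k m) (S K))
      by (intro m; now rewrite sum_Sn).
    split.
    + apply (ex_series_ext _ _ He).
      apply (ex_series_plus (V := R_NormedModule) _ _ IHe (Hu (S K))).
    + rewrite sum_Sn, IH. change plus with Rplus.
      rewrite <- Series_plus by trivial. now apply Series_ext.
Qed.

Lemma sum_n_le_Series (a : nat -> R) (K : nat) :
  (forall k, 0 <= a k) -> ex_series a -> sum_n a K <= Series a.
Proof.
  intros Ha He.
  apply (is_lim_seq_incr_compare (sum_n a) (Series a)).
  - now apply (Series_correct a).
  - intro n. rewrite sum_Sn. change plus with Rplus. specialize (Ha (S n)). lra.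
Qed.

Lemma term_le_Series (a : nat -> R) (K : nat) :
  (forall k, 0 <= a k) -> ex_series a -> a K <= Series a.
Proof.
  intros Ha He. apply Rle_trans with (sum_n a K); [|now apply sum_n_le_Series].
  destruct K as [|K]; [rewrite sum_O; lra|].
  rewrite sum_Sn. change plus with Rplus.
  assert (0 <= sum_n a K); [|lra].
  rewrite sum_n_Reals. now apply cond_pos_sum.
Qed.

(** Fubini for series. A finite sum over [k] commutes with the series over [m], and the partial row
    sums are dominated by the absolute row sums, hence by [b]; dominated convergence then lets the
    number of summed columns go to infinity. *)
Lemma is_series_Series_comm (u : nat -> nat -> R) (b : nat -> R) :
  (forall m, ex_series (fun k => Rabs (u m k))) ->
  (forall m, Series (fun k => Rabs (u m k)) <= b m) -> ex_series b ->
  is_series (fun k => Series (fun m => u m k)) (Series (fun m => Series (u m))).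
Proof.
  intros Hu Hub Hb.
  assert (Hcol : forall k, ex_series (fun m => u m k)).
  { intro k. apply (ex_series_le (fun m => u m k) b); [|exact Hb].
    intro m. apply Rle_trans with (2 := Hub m).
    apply (term_le_Series (fun k => Rabs (u m k)) k); [|apply Hu].
    intro; apply Rabs_pos. }
  change (is_lim_seq (sum_n (fun k => Series (fun m => u m k)))
            (Series (fun m => Series (u m)))).
  apply (is_lim_seq_ext (fun K => Series (fun m => sum_n (u m) K))).
  { intro K. symmetry. now apply (sum_n_Series (fun k m => u m k)). }
  apply (is_lim_seq_Series_dominated _ b); [| exact Hb |].
  - intros K m. apply Rle_trans with (2 := Hub m).
    apply Rle_trans with (sum_n (fun k => Rabs (u m k)) K).
    + rewrite !sum_n_Reals. apply Rsum_abs.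
    + apply sum_n_le_Series; [intro; apply Rabs_pos | apply Hu].
  - intro m. apply (Series_correct (u m)), ex_series_Rabs, Hu.
Qed.

(** * Degenerate falling factorials and the binomial series *)

Fixpoint falling (lam : R) (k : nat) (x : R) : R :=
  match k with
  | O => 1
  | S j => falling lam j x * (x - INR j * lam)
  end.

(** For nonzero [lam] this is [lam ^ k] times the generalized binomial coefficient of [x / lam] over
    [k]. *)
Definition binomial_coef (lam x : R) (k : nat) : R :=
  falling lam k x / INR (fact k).

(** This recurrence gives both the ratio test and the differential equation of the series. *)
Lemma binomial_coef_S (lam x : R) (k : nat) :
  INR (S k) * binomial_coef lam x (S k) = (x - INR k * lam) * binomial_coef lam x k.
Proof.
  unfold binomial_coef. rewrite fact_simpl, mult_INR. cbn [falling].
  pose proof (INR_fact_neq_0 k). assert (INR (S k) <> 0) by now apply not_0_INR.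
  field. now split.
Qed.

(* Replacing [lam] by [- Rabs lam] makes all factors nonnegative: this gives the
   majorant of the binomial series. *)
Lemma Rabs_falling_le (lam x y : R) (k : nat) :
  0 <= x <= y -> Rabs (falling lam k x) <= falling (- Rabs lam) k y.
Proof.
  intros Hxy. induction k as [|k IH]; cbn [falling].
  - rewrite Rabs_R1; lra.
  - rewrite Rabs_mult. apply Rmult_le_compat; try apply Rabs_pos; [exact IH|].
    apply Rle_trans with (1 := Rabs_triang _ _).
    rewrite Rabs_Ropp, Rabs_mult, (Rabs_pos_eq x), (Rabs_pos_eq (INR k))
      by (try apply pos_INR; apply Hxy).
    lra.
Qed.

Lemma Rabs_binomial_coef_le (lam x y : R) (k : nat) :
  0 <= x <= y -> Rabs (binomial_coef lam x k) <= binomial_coef (- Rabs lam) y k.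
Proof.
  intros Hxy. unfold binomial_coef, Rdiv.
  rewrite Rabs_mult, (Rabs_pos_eq (/ _))
    by (apply Rlt_le, Rinv_0_lt_compat, INR_fact_lt_0).
  apply Rmult_le_compat_r; [apply Rlt_le, Rinv_0_lt_compat, INR_fact_lt_0|].
  now apply Rabs_falling_le.
Qed.

(** The ratio test requires nonzero coefficients. Those for [lam] itself vanish from some index on
    when [x] is a natural multiple of [lam]; those of the majorant never do. *)
Lemma binomial_coef_pos (lam x : R) (k : nat) :
  0 < x -> 0 < binomial_coef (- Rabs lam) x k.
Proof.
  intros Hx. apply Rdiv_lt_0_compat; [|apply INR_fact_lt_0].
  induction k as [|k IH]; cbn [falling]; [lra|].
  apply Rmult_lt_0_compat; [exact IH|].
  pose proof (Rmult_le_pos _ _ (pos_INR k) (Rabs_pos lam)). lra.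
Qed.

(** Ratio test: consecutive coefficients have ratio [(x + n |lam|) / (n + 1)], which tends to
    [|lam|]. *)
Lemma CV_disk_binomial_pos (lam x t : R) :
  lam <> 0 -> 0 < x -> Rabs (lam * t) < 1 -> CV_disk (binomial_coef (- Rabs lam) x) t.
Proof.
  intros Hlam Hx Ht. pose proof (Rabs_pos_lt lam Hlam) as Hl.
  apply (CV_disk_DAlembert _ _ (Rabs lam)).
  - intro n. apply Rgt_not_eq, binomial_coef_pos, Hx.
  - apply (is_lim_seq_ext (fun n => Rabs lam + (x - Rabs lam) * / INR (S n))).
    + intro n. pose proof (binomial_coef_S (- Rabs lam) x n) as HS.
      pose proof (binomial_coef_pos lam x n Hx).
      pose proof (binomial_coef_pos lam x (S n) Hx).
      rewrite (Rabs_pos_eq (_ / _)) by now apply Rlt_le, Rdiv_lt_0_compat.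
      assert (Hn : INR (S n) <> 0) by now apply not_0_INR.
      apply (Rmult_eq_reg_l (INR (S n))); [|exact Hn].
      unfold Rdiv. rewrite <- Rmult_assoc, HS. rewrite S_INR in *. field. lra.
    + replace (Finite (Rabs lam)) with (Finite (Rabs lam + (x - Rabs lam) * 0))
        by (f_equal; ring).
      apply is_lim_seq_plus'; [apply is_lim_seq_const|].
      apply (is_lim_seq_scal_l _ _ 0).
      apply (is_lim_seq_incr_1 (fun n => / INR n)).
      apply (is_lim_seq_inv _ p_infty); [apply is_lim_seq_INR | easy].
  - right. split; [lra|]. rewrite Rabs_mult in Ht.
    apply (Rmult_lt_reg_l (Rabs lam)); [exact Hl|].
    rewrite Rinv_r; lra.
Qed.

Lemma CV_disk_binomial (lam x t : R) :
  lam <> 0 -> 0 <= x -> Rabs (lam * t) < 1 -> CV_disk (binomial_coef lam x) t.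
Proof.
  intros Hlam Hx Ht.
  (* The majorant is taken at [x + 1] because positivity of its coefficients needs a positive
     argument and [x] may be 0. *)
  assert (Hm : CV_disk (binomial_coef (- Rabs lam) (x + 1)) t)
    by (apply CV_disk_binomial_pos; trivial; lra).
  apply (ex_series_le (V := R_CompleteNormedModule) _ _) with (2 := Hm).
  intro n. change norm with Rabs. cbv beta. rewrite Rabs_Rabsolu, !Rabs_mult.
  apply Rmult_le_compat_r; [apply Rabs_pos|].
  apply Rle_trans with (2 := Rle_abs _). apply Rabs_binomial_coef_le; lra.
Qed.

(** Convergence at [t] alone would allow [t] to lie on the boundary circle. The midpoint [s] of
    [|t|] and [1 / |lam|] still gives convergence, so the terms there tend to 0, which is impossible
    beyond the radius. *)
Lemma CV_radius_binomial (lam x t : R) :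
  lam <> 0 -> 0 <= x -> Rabs (lam * t) < 1 ->
  Rbar_lt (Rabs t) (CV_radius (binomial_coef lam x)).
Proof.
  intros Hlam Hx Ht. pose proof (Rabs_pos_lt lam Hlam) as Hl.
  rewrite Rabs_mult in Ht.
  set (s := (Rabs t + / Rabs lam) / 2).
  assert (Rabs t < / Rabs lam).
  { apply (Rmult_lt_reg_l (Rabs lam)); [exact Hl|]. rewrite Rinv_r; lra. }
  pose proof (Rabs_pos t).
  apply Rbar_lt_le_trans with (Finite s); [simpl; unfold s; lra|].
  apply Rbar_not_lt_le. intro Hs.
  assert (Hss : Rabs s = s) by (apply Rabs_pos_eq; unfold s; lra).
  rewrite <- Hss in Hs. apply CV_disk_outside in Hs. apply Hs.
  apply (ex_series_lim_0 (fun n => binomial_coef lam x n * s ^ n)).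
  apply ex_series_Rabs, CV_disk_binomial; trivial.
  rewrite Rabs_mult, Hss.
  apply Rlt_le_trans with (Rabs lam * / Rabs lam); [|rewrite Rinv_r; lra].
  apply Rmult_lt_compat_l; [exact Hl|]. unfold s; lra.
Qed.

(** Comparing coefficients turns the equation into the recurrence [binomial_coef_S]; multiplication
    by [t] is the index shift [PS_incr_1]. *)
Lemma PSeries_binomial_ode (lam x t : R) :
  lam <> 0 -> 0 <= x -> Rabs (lam * t) < 1 ->
  (1 + lam * t) * PSeries (PS_derive (binomial_coef lam x)) t
  = x * PSeries (binomial_coef lam x) t.
Proof.
  intros Hlam Hx Ht. set (c := binomial_coef lam x).
  assert (Hd : ex_pseries (PS_derive c) t)
    by (apply ex_pseries_derive, CV_radius_binomial; trivial).
  rewrite <- (PSeries_scal x).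
  transitivity (PSeries (PS_plus (PS_derive c)
                           (PS_scal lam
                              (PS_incr_1 (V := R_NormedModule) (PS_derive c)))) t).
  - rewrite PSeries_plus, PSeries_scal, (PSeries_incr_1 (PS_derive c)); [ring | exact Hd |].
    apply ex_pseries_scal; [apply Rmult_comm|]. now apply ex_pseries_incr_1.
  - apply PSeries_ext. intro n. unfold PS_plus, PS_scal, PS_incr_1, PS_derive.
    change plus with Rplus. change scal with Rmult. unfold c.
    destruct n as [|n].
    + rewrite (binomial_coef_S lam x 0). change zero with 0. simpl INR. ring.
    + rewrite (binomial_coef_S lam x (S n)). ring.
Qed.

Lemma is_derive_deg_exp (lam x t : R) :
  lam <> 0 -> 0 < 1 + lam * t ->
  is_derive (deg_exp lam x) t (x * deg_exp lam (x - lam) t).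
Proof.
  intros Hlam Ht. unfold deg_exp.
  assert (E : x * Rpower (1 + lam * t) ((x - lam) / lam)
              = lam * (x / lam * Rpower (1 + lam * t) (x / lam - 1))).
  { replace ((x - lam) / lam) with (x / lam - 1) by (field; trivial).
    field; trivial. }
  rewrite E.
  apply (is_derive_comp (fun s => Rpower s (x / lam)) (fun t => 1 + lam * t)).
  - apply is_derive_Reals, derivable_pt_lim_power, Ht.
  - auto_derive; [trivial | ring].
Qed.

Lemma deg_exp_plus (lam x y t : R) :
  deg_exp lam (x + y) t = deg_exp lam x t * deg_exp lam y t.
Proof. unfold deg_exp. now rewrite Rdiv_plus_distr, Rpower_plus. Qed.

Lemma deg_exp_pos (lam x t : R) : 0 < deg_exp lam x t.
Proof. apply exp_pos. Qed.

Lemma deg_exp_0_l (lam t : R) : deg_exp lam 0 t = 1.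
Proof. unfold deg_exp, Rpower, Rdiv. rewrite !Rmult_0_l. apply exp_0. Qed.

Lemma deg_exp_0_r (lam x : R) : deg_exp lam x 0 = 1.
Proof.
  unfold deg_exp, Rpower. rewrite Rmult_0_r, Rplus_0_r, ln_1, Rmult_0_r.
  apply exp_0.
Qed.

Lemma deg_exp_INR (lam t : R) (m : nat) : deg_exp lam (INR m) t = deg_exp lam 1 t ^ m.
Proof.
  induction m as [|m IH]; [apply deg_exp_0_l|].
  rewrite S_INR, deg_exp_plus, IH. simpl. ring.
Qed.

Lemma Series_binomial (lam x t : R) :
  lam <> 0 -> 0 <= x -> Rabs (lam * t) < 1 ->
  Series (fun k => binomial_coef lam x k * t ^ k) = deg_exp lam x t.
Proof.
  intros Hlam Hx Ht. change (PSeries (binomial_coef lam x) t = deg_exp lam x t).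
  set (c := binomial_coef lam x).
  (* By the differential equation of the series, [g] is constant on the disk. *)
  set (g := fun s => PSeries c s * deg_exp lam (- x) s).
  assert (Hg : forall s, Rabs (lam * s) < 1 -> is_derive g s 0).
  { intros s Hs. assert (H1 : 0 < 1 + lam * s) by (apply Rabs_def2 in Hs; lra).
    pose proof (Derive.is_derive_mult _ _ s _ _
      (is_derive_PSeries c s (CV_radius_binomial lam x s Hlam Hx Hs))
      (is_derive_deg_exp lam (- x) s Hlam H1)) as H.
    replace 0 with (PSeries (PS_derive c) s * deg_exp lam (- x) s
                    + PSeries c s * (- x * deg_exp lam (- x - lam) s)); [exact H|].
    pose proof (PSeries_binomial_ode lam x s Hlam Hx Hs) as Hode. fold c in Hode.
    (* Splitting off [e_lam^lam(s) = 1 + lam s] produces the factor that the differential equation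
       needs, and the two halves of the derivative cancel. *)
    assert (He : deg_exp lam (- x) s = (1 + lam * s) * deg_exp lam (- x - lam) s).
    { replace (- x) with (lam + (- x - lam)) at 1 by ring.
      rewrite deg_exp_plus. f_equal. unfold deg_exp.
      rewrite Rdiv_diag by trivial. now apply Rpower_1. }
    rewrite He, <- Rmult_assoc, (Rmult_comm _ (1 + _)), Hode. ring. }
  assert (Hg0 : g t = g 0).
  { assert (Hst : forall s, Rabs s <= Rabs t -> is_derive g s zero).
    { intros s Hs. apply Hg. rewrite Rabs_mult in *.
      apply Rle_lt_trans with (2 := Ht).
      apply Rmult_le_compat_l; [apply Rabs_pos | exact Hs]. }
    destruct (Rtotal_order t 0) as [H | [-> | H]]; trivial.
    - apply (eq_is_derive (V := R_NormedModule)); trivial.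
      intros s Hs. apply Hst. rewrite !Rabs_left1; lra.
    - symmetry. apply (eq_is_derive (V := R_NormedModule)); trivial.
      intros s Hs. apply Hst. rewrite !Rabs_pos_eq; lra. }
  unfold g in Hg0. rewrite PSeries_0, deg_exp_0_r in Hg0.
  assert (Hc0 : c O = 1) by (unfold c, binomial_coef; simpl; field).
  rewrite Hc0, Rmult_1_r in Hg0.
  pose proof (deg_exp_plus lam (- x) x t) as Hp.
  rewrite Rplus_opp_l, deg_exp_0_l in Hp.
  apply (Rmult_eq_reg_r (deg_exp lam (- x) t)); [|apply Rgt_not_eq, deg_exp_pos].
  rewrite Hg0. lra.
Qed.

(** * Diagonal action of the number operator and Poisson weights *)

Lemma number_op_coord (psi : state) (m : nat) :
  number_op psi m = (RtoC (INR m) * psi m)%C.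
Proof.
  unfold number_op, creation, annihilation. destruct m as [|m].
  - simpl INR. ring.
  - rewrite Cmult_assoc, <- RtoC_mult, sqrt_sqrt; [reflexivity | apply pos_INR].
Qed.

(** Every factor is diagonal in the number basis, so the product acts on each coordinate by the
    scalar falling factorial. The induction keeps [psi] general, since each step changes the state
    acted upon. *)
Lemma op_falling_number (lam c : R) (k : nat) (psi : state) (m : nat) :
  op_falling lam k (op_shift number_op c) psi m
  = (RtoC (falling lam k (INR m + c)) * psi m)%C.
Proof.
  revert psi. induction k as [|k IH]; intro psi; cbn [op_falling falling].
  - ring.
  - rewrite IH. unfold op_shift. rewrite number_op_coord.
    rewrite RtoC_mult, RtoC_minus, RtoC_plus, RtoC_opp. ring.
Qed.

(* [|<m|z>|^2] for [x = |z|^2]. *)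
Definition poisson (x : R) (m : nat) : R := exp (- x) * (x ^ m / INR (fact m)).

Lemma poisson_pos (x : R) (m : nat) : 0 <= x -> 0 <= poisson x m.
Proof.
  intros Hx. apply Rmult_le_pos; [apply Rlt_le, exp_pos|].
  apply Rdiv_le_0_compat; [now apply pow_le | apply INR_fact_lt_0].
Qed.

(** The Poisson generating function. It evaluates the final sum over [m], and also shows that any
    geometric growth in [m] is summable against the Poisson weights. *)
Lemma is_series_poisson (x c : R) :
  is_series (fun m => poisson x m * c ^ m) (exp (x * (c - 1))).
Proof.
  assert (E : exp (x * (c - 1)) = exp (- x) * exp (x * c))
    by (rewrite <- exp_plus; f_equal; ring).
  rewrite E.
  apply (is_series_ext
           (fun m => scal (exp (- x)) (scal (pow_n (x * c) m) (/ INR (fact m))))).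
  - intro m. rewrite pow_n_pow. change scal with Rmult. unfold poisson, Rdiv.
    rewrite Rpow_mult_distr. apply Rminus_diag_uniq. ring.
  - apply (is_series_scal (V := R_NormedModule) (exp (- x))), is_exp_Reals.
Qed.

Lemma Cmod_coherent_sqr (z : C) (m : nat) :
  Cmod (coherent z m) ^ 2 = poisson (Cmod z ^ 2) m.
Proof.
  unfold coherent, poisson.
  assert (Hf : 0 < sqrt (INR (fact m))) by (apply sqrt_lt_R0, INR_fact_lt_0).
  rewrite Cmod_mult, Cmod_div, Cmod_pow, !Cmod_R
    by (intro H; apply RtoC_inj in H; lra).
  rewrite (Rabs_pos_eq (exp _)) by apply Rlt_le, exp_pos.
  rewrite (Rabs_pos_eq (sqrt _)) by lra.
  assert (He : forall y, exp (- y) = exp (- y / 2) ^ 2)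
    by (intro y; rewrite <- Rsqr_pow2; unfold Rsqr; rewrite <- exp_plus; f_equal; field).
  assert (Hs : sqrt (INR (fact m)) ^ 2 = INR (fact m)) by apply pow2_sqrt, pos_INR.
  set (s := sqrt (INR (fact m))) in *. clearbody s.
  rewrite He, <- Hs, <- (pow_mult (Cmod z)), Nat.mul_comm, pow_mult. field. lra.
Qed.

Lemma CSeries_RtoC (u : nat -> C) (a : nat -> R) :
  (forall m, u m = RtoC (a m)) -> CSeries u = RtoC (Series a).
Proof.
  intros Hu. unfold CSeries, RtoC. f_equal.
  - apply Series_ext. intro m. now rewrite Hu.
  (* Writing the zero imaginary parts as [0 * 0] lets the factor 0 be pulled out of the series,
     which gives the value 0. *)
  - rewrite (Series_ext _ (fun m => 0 * 0)).
    + rewrite Series_scal_l. ring.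
    + intro m. rewrite Hu. simpl. ring.
Qed.

Lemma expectation_falling (lam c : R) (k : nat) (z : C) :
  expectation z (op_falling lam k (op_shift number_op c))
  = RtoC (Series (fun m => poisson (Cmod z ^ 2) m * falling lam k (INR m + c))).
Proof.
  apply CSeries_RtoC. intro m.
  rewrite op_falling_number, <- Cmod_coherent_sqr, RtoC_mult, Cmod2_conj. ring.
Qed.

(** * Absolute bounds and square summability *)

Lemma binomial_abs_series_le (lam x t : R) :
  lam <> 0 -> 0 <= x -> Rabs (lam * t) < 1 ->
  Series (fun k => Rabs (binomial_coef lam x k * t ^ k))
  <= deg_exp (- Rabs lam) x (Rabs t).
Proof.
  intros Hlam Hx Ht.
  assert (Hlam' : - Rabs lam <> 0) by (pose proof (Rabs_pos_lt lam Hlam); lra).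
  assert (Ht' : Rabs (- Rabs lam * Rabs t) < 1)
    by (rewrite Rabs_mult, Rabs_Ropp, !Rabs_Rabsolu, <- Rabs_mult; exact Ht).
  rewrite <- Series_binomial by trivial. apply Series_le.
  - intro k. split; [apply Rabs_pos|].
    rewrite Rabs_mult, RPow_abs. apply Rmult_le_compat_r; [apply Rabs_pos|].
    apply Rabs_binomial_coef_le; lra.
  - now apply ex_series_Rabs, CV_disk_binomial.
Qed.

(* The absolute binomial series at the single point [t = 1 / (2 |lam|)] bounds each
   of its terms. *)
Lemma falling_geometric_bound (lam : R) (k r : nat) :
  lam <> 0 ->
  exists A D, forall m, Rabs (falling lam k (INR m + INR r)) <= A * D ^ m.
Proof.
  intros Hlam. pose proof (Rabs_pos_lt lam Hlam) as Hl.
  set (t := / (2 * Rabs lam)).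
  assert (Htp : 0 < t) by (apply Rinv_0_lt_compat; lra).
  assert (Ht : Rabs (lam * t) < 1).
  { rewrite Rabs_mult, (Rabs_pos_eq t) by lra. unfold t.
    replace (Rabs lam * / (2 * Rabs lam)) with (/ 2) by (field; lra). lra. }
  set (D := deg_exp (- Rabs lam) 1 (Rabs t)).
  exists (INR (fact k) / t ^ k * D ^ r), D. intro m.
  rewrite <- plus_INR. set (x := INR (m + r)).
  assert (Hx : 0 <= x) by apply pos_INR.
  pose proof (term_le_Series (fun k => Rabs (binomial_coef lam x k * t ^ k)) k
    (fun _ => Rabs_pos _) (CV_disk_binomial lam x t Hlam Hx Ht)) as H.
  apply (fun H' => Rle_trans _ _ _ H' (binomial_abs_series_le lam x t Hlam Hx Ht)) in H.
  (* At the integer argument [m + r] the bound is the power [D ^ (m + r)], whose part [D ^ r] goes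
     into the constant [A]. *)
  unfold x in H at 2. rewrite deg_exp_INR in H. fold D in H.
  assert (Hf : 0 < INR (fact k)) by apply INR_fact_lt_0.
  assert (Htk : 0 < t ^ k) by now apply pow_lt.
  replace (INR (fact k) / t ^ k * D ^ r * D ^ m)
    with (INR (fact k) / t ^ k * D ^ (m + r)) by (rewrite pow_add; ring).
  replace (falling lam k x)
    with (INR (fact k) / t ^ k * (binomial_coef lam x k * t ^ k))
    by (unfold binomial_coef; field; lra).
  rewrite Rabs_mult, (Rabs_pos_eq (_ / _)) by (apply Rlt_le, Rdiv_lt_0_compat; trivial).
  apply Rmult_le_compat_l; [apply Rlt_le, Rdiv_lt_0_compat; trivial | exact H].
Qed.

(** The geometric bound reduces the squared norm to a multiple of the Poisson generating function at
    [D ^ 2]. *)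
Lemma in_l2_falling_coherent (lam : R) (k r : nat) (z : C) :
  lam <> 0 -> in_l2 (op_falling lam k (op_shift number_op (INR r)) (coherent z)).
Proof.
  intros Hlam. destruct (falling_geometric_bound lam k r Hlam) as (A & D & HAD).
  set (x := Cmod z ^ 2). assert (Hx : 0 <= x) by apply pow2_ge_0.
  apply (ex_series_le (V := R_CompleteNormedModule) _
           (fun m => A ^ 2 * (poisson x m * (D ^ 2) ^ m))).
  - intro m. change norm with Rabs. cbv beta.
    rewrite op_falling_number, Cmod_mult, Cmod_R, Rpow_mult_distr, Cmod_coherent_sqr.
    pose proof (poisson_pos x m Hx).
    rewrite Rabs_pos_eq by (apply Rmult_le_pos; [apply pow2_ge_0 | trivial]).
    replace (A ^ 2 * (poisson x m * (D ^ 2) ^ m)) with ((A * D ^ m) ^ 2 * poisson x m)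
      by (rewrite Rpow_mult_distr, <- !pow_mult, (Nat.mul_comm m 2); ring).
    apply Rmult_le_compat_r; trivial.
    apply pow_incr. split; [apply Rabs_pos | apply HAD].
  - apply (ex_series_scal_l (V := R_NormedModule) (A ^ 2)
             (fun m => poisson x m * (D ^ 2) ^ m)). eexists. apply is_series_poisson.
Qed.

(** * The closed form of the expectation and its derivative *)

Definition coherent_gf (lam : R) (r : nat) (x t : R) : R :=
  exp (x * (deg_exp lam 1 t - 1)) * deg_exp lam (INR r) t.

(** The interchange is licensed by the row bound [poisson x m * D ^ (m + r)], summable in [m] by the
    generating function at [D]. *)
Lemma is_series_coherent_gf (lam : R) (r : nat) (x t : R) :
  lam <> 0 -> 0 <= x -> Rabs (lam * t) < 1 ->
  is_series (fun k => Series (fun m => poisson x m * falling lam k (INR m + INR r))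
                      * (t ^ k / INR (fact k)))
            (coherent_gf lam r x t).
Proof.
  intros Hlam Hx Ht.
  set (u := fun m k => poisson x m * (binomial_coef lam (INR (m + r)) k * t ^ k)).
  set (D := deg_exp (- Rabs lam) 1 (Rabs t)).
  apply (is_series_ext (fun k => Series (fun m => u m k))).
  { intro k. rewrite <- Series_scal_r. apply Series_ext. intro m.
    unfold u, binomial_coef. rewrite plus_INR. field. apply INR_fact_neq_0. }
  replace (coherent_gf lam r x t) with (Series (fun m => Series (u m))).
  - assert (Habs : forall m k, Rabs (u m k)
              = poisson x m * Rabs (binomial_coef lam (INR (m + r)) k * t ^ k)).
    { intros m k. unfold u.
      now rewrite Rabs_mult, (Rabs_pos_eq (poisson x m)) by now apply poisson_pos. }
    apply (is_series_Series_comm u (fun m => poisson x m * D ^ m * D ^ r)).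
    + intro m. eapply ex_series_ext; [intro k; symmetry; apply Habs|].
      apply (ex_series_scal_l (V := R_NormedModule) (poisson x m)
               (fun k => Rabs (binomial_coef lam (INR (m + r)) k * t ^ k))).
      apply CV_disk_binomial; trivial; apply pos_INR.
    + intro m. rewrite (Series_ext _ _ (Habs m)), Series_scal_l, Rmult_assoc, <- pow_add.
      apply Rmult_le_compat_l; [now apply poisson_pos|].
      unfold D. rewrite <- deg_exp_INR.
      apply binomial_abs_series_le; trivial; apply pos_INR.
    + apply ex_series_scal_r. eexists. apply is_series_poisson.
  - rewrite (Series_ext _ (fun m => poisson x m * deg_exp lam 1 t ^ m
                                    * deg_exp lam 1 t ^ r)).
    + rewrite Series_scal_r, (is_series_unique _ _ (is_series_poisson x _)).
      unfold coherent_gf. now rewrite deg_exp_INR.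
    + intro m. unfold u. rewrite Series_scal_l, Series_binomial by (trivial; apply pos_INR).
      rewrite deg_exp_INR, pow_add. ring.
Qed.

Lemma is_derive_coherent_gf (lam : R) (r : nat) (x t : R) :
  lam <> 0 -> 0 < 1 + lam * t ->
  is_derive (coherent_gf lam r x) t
    ((x * deg_exp lam (1 - lam) t + INR r * deg_exp lam (- lam) t)
     * coherent_gf lam r x t).
Proof.
  intros Hlam Ht.
  assert (H1 : is_derive (fun s => exp (x * (deg_exp lam 1 s - 1))) t
                 (scal (x * (1 * deg_exp lam (1 - lam) t))
                       (exp (x * (deg_exp lam 1 t - 1))))).
  { apply (is_derive_comp exp (fun s => x * (deg_exp lam 1 s - 1))).
    - apply is_derive_exp.
    - apply is_derive_scal.
      replace (1 * deg_exp lam (1 - lam) t)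
        with (minus (1 * deg_exp lam (1 - lam) t) zero) by apply Rminus_0_r.
      apply (is_derive_minus (deg_exp lam 1) (fun _ => 1)).
      + now apply is_derive_deg_exp.
      + apply (is_derive_const (V := R_NormedModule) 1). }
  pose proof (Derive.is_derive_mult _ _ t _ _ H1
    (is_derive_deg_exp lam (INR r) t Hlam Ht)) as H.
  unfold coherent_gf. eapply eq_ind; [exact H|].
  (* Splitting off [e_lam^r(t)] lets [coherent_gf] factor out of both terms of the product rule. *)
  assert (E : deg_exp lam (INR r - lam) t = deg_exp lam (INR r) t * deg_exp lam (- lam) t)
    by apply deg_exp_plus.
  rewrite E.
  change scal with Rmult. apply Rminus_diag_uniq. ring.
Qed.

(** * Transfer from real to complex values and conclusion *)

Lemma scal_RtoC_1 (y : R) : @scal R_AbsRing C_R_NormedModule y (RtoC 1) = RtoC y.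
Proof.
  apply injective_projections; simpl; [apply Rmult_1_r | apply Rmult_0_r].
Qed.

(** The embedding [RtoC] is scaling of the vector 1, so partial sums pass through it by
    distributivity and the limit by continuity of scaling. *)
Lemma is_series_RtoC (a : nat -> R) (l : R) :
  is_series a l ->
  @is_series R_AbsRing C_R_NormedModule (fun n => RtoC (a n)) (RtoC l).
Proof.
  intros Ha.
  apply (filterlim_ext (fun n => @scal _ C_R_NormedModule (sum_n a n) (RtoC 1))).
  - intro n. induction n as [|n IH].
    + now rewrite !sum_O, scal_RtoC_1.
    + rewrite !sum_Sn, <- IH, <- (scal_RtoC_1 (a (S n))). apply (@scal_distr_r _ C_R_NormedModule).
  - rewrite <- (scal_RtoC_1 l). apply (filterlim_comp _ _ _ _ (fun y => @scal _ C_R_NormedModule y (RtoC 1))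
                                 _ _ _ Ha).
    apply (@filterlim_scal_l _ C_R_NormedModule).
Qed.

Lemma is_derive_RtoC (f : R -> R) (t l : R) :
  is_derive f t l ->
  @is_derive R_AbsRing C_R_NormedModule (fun s => RtoC (f s)) t (RtoC l).
Proof.
  intros Hf.
  rewrite <- (scal_RtoC_1 l).
  apply (is_derive_ext (fun s => @scal _ C_R_NormedModule (f s) (RtoC 1)));
    [intro; apply scal_RtoC_1|].
  now apply (is_derive_scal_l (V := C_R_NormedModule)).
Qed.

Lemma deg_exp_term_RtoC (lam : R) (r : nat) (z : C) (t : R) (k : nat) :
  deg_exp_term lam r z t k
  = RtoC (Series (fun m => poisson (Cmod z ^ 2) m * falling lam k (INR m + INR r))
          * (t ^ k / INR (fact k))).
Proof. unfold deg_exp_term. now rewrite expectation_falling, RtoC_mult. Qed.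

Lemma deg_exp_expectation_eq (lam : R) (r : nat) (z : C) (t : R) :
  lam <> 0 -> Rabs (lam * t) < 1 ->
  deg_exp_expectation lam r z t = RtoC (coherent_gf lam r (Cmod z ^ 2) t).
Proof.
  intros Hlam Ht. unfold deg_exp_expectation.
  rewrite (CSeries_RtoC _ _ (deg_exp_term_RtoC lam r z t)). f_equal.
  apply is_series_unique, is_series_coherent_gf; trivial. apply pow2_ge_0.
Qed.

Theorem theorem4 (lam : R) (hlam : lam <> 0) (r : nat) (z : C) :
  (forall k : nat,
     in_l2 (op_falling lam k (op_shift number_op (INR r)) (coherent z))) /\
  (forall t : R, Rabs (lam * t) < 1 ->
     @ex_series R_AbsRing C_R_NormedModule (deg_exp_term lam r z t) /\
     deg_exp_expectation lam r z t <> RtoC 0 /\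
     exists df : C,
       @is_derive R_AbsRing C_R_NormedModule (deg_exp_expectation lam r z) t df /\
       (df / deg_exp_expectation lam r z t)%C =
         RtoC (Cmod z ^ 2 * deg_exp lam (1 - lam) t
               + INR r * deg_exp lam (- lam) t)).
Proof.
  split; [intro k; now apply in_l2_falling_coherent|].
  intros t Ht. set (x := Cmod z ^ 2).
  assert (Hx : 0 <= x) by apply pow2_ge_0.
  assert (Hpos : 0 < coherent_gf lam r x t)
    by (apply Rmult_lt_0_compat; [apply exp_pos | apply deg_exp_pos]).
  assert (Hne : RtoC (coherent_gf lam r x t) <> RtoC 0)
    by (intro H; apply RtoC_inj in H; lra).
  rewrite (deg_exp_expectation_eq lam r z t hlam Ht). fold x.
  split; [|split; [exact Hne|]].
  - exists (RtoC (coherent_gf lam r x t)).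
    eapply is_series_ext; [intro k; symmetry; apply deg_exp_term_RtoC|].
    now apply is_series_RtoC, is_series_coherent_gf.
  - set (w := x * deg_exp lam (1 - lam) t + INR r * deg_exp lam (- lam) t).
    exists (RtoC (w * coherent_gf lam r x t)). split.
    (* The closed form is established only for [|lam s| < 1]; this set is open by continuity of
       [s -> |lam s|], so the two functions agree near [t], which suffices for the derivative. *)
    + apply (is_derive_ext_loc (fun s => RtoC (coherent_gf lam r x s))).
      * assert (Hc : continuous (fun s => Rabs (lam * s)) t).
        { apply (continuous_comp (fun s => lam * s) Rabs); [|apply continuous_Rabs].
          apply (ex_derive_continuous (V := R_NormedModule)). now auto_derive. }
        apply (filter_imp (fun s => Rabs (lam * s) < 1)).
        -- intros s Hs. symmetry. now apply deg_exp_expectation_eq.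
        -- exact (Hc (fun y => y < 1) (open_lt 1 _ Ht)).
      * apply is_derive_RtoC, is_derive_coherent_gf; trivial.
        apply Rabs_def2 in Ht. lra.
    + rewrite RtoC_mult. field. exact Hne.
Qed.
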